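(* Let $(M,g,q)$ be a four-dimensional Riemannian manifold with circulant metric $g$ and circulant structure $q$ as defined in the context, whose curvature tensor $R$ of type $(0,4)$ satisfies $$R(x,y,qz,qu)=R(x,y,z,u)$$ for all vectors $x,y,z,u$. Let $p\in M$ and let $x\in T_pM$ induce a $q$-basis of $T_pM$. Then the sectional curvature $\mu$ satisfies $$\mu(x,qx)=\mu(qx,q^{2}x)=\mu(q^{2}x,q^{3}x)=\mu(q^{3}x,x)$$ and $$\mu(x,q^{2}x)=\mu(qx,q^{3}x)=0.$$
   Context: Setting: $M$ is a four-dimensional smooth manifold with a Riemannian metric $g$ and an endomorphism field $q$ of the tangent bundle such that near every point there are local coordinates $(X^1,X^2,X^3,X^4)$ in which $$(g_{ij})=\begin{pmatrix} A & B & C & B\\ B & A & B & C\\ C & B & A & B\\ B & C & B & A\end{pmatrix},$$ where $A,B,C$ are smooth functions with $0<B<C<A$ (this makes $g$ positive definite), and $q$ has the constant matrix $$(q_i^s)=\begin{pmatrix}0&1&0&0\\0&0&1&0\\0&0&0&1\\1&0&0&0\end{pmatrix},$$ so that for a tangent vector with coordinates $x=(x^1,x^2,x^3,x^4)$ one has $qx=(x^2,x^3,x^4,x^1)$. In particular $q^4=\mathrm{id}$ and $q^2\neq\pm\mathrm{id}$. Such a manifold is denoted $(M,g,q)$. A basis of $T_pM$ of the form $\{x,qx,q^2x,q^3x\}$ is called a $q$-basis; in this case one says that $x$ induces a $q$-basis of $T_pM$. $\nabla$ is the Riemannian (Levi-Civita) connection of $g$ and $R$ is its curvature tensor field of type $(0,4)$.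 The sectional curvature of the 2-plane spanned by linearly independent $x,y\in T_pM$ is $$\mu(x,y)=\frac{R(x,y,x,y)}{g(x,x)g(y,y)-g(x,y)^{2}}.$$ *)

(* Defs.v *)
From HB Require Import structures.
From mathcomp Require Import all_boot all_order all_algebra.
From mathcomp Require Import all_classical all_reals all_analysis.
Set Implicit Arguments.
Unset Strict Implicit.
Unset Printing Implicit Defensive.
Import Order.TTheory GRing.Theory Num.Theory.
Import numFieldNormedType.Exports.
Local Open Scope classical_set_scope.
Local Open Scope ring_scope.

(* C^k and C^oo maps on an open subset U of R^4; the derivatives at a point of
   U only depend on the values of f near that point. *)
Fixpoint Ck_on (R : realType) (W : normedModType R) (k : nat)
    (U : set 'rV[R]_4) (f : 'rV[R]_4 -> W) : Prop :=
  match k with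
  | 0 => forall y, U y -> {for y, continuous f}
  | k'.+1 => (forall y, U y -> differentiable f y) /\
             (forall v, Ck_on k' U ('D_v f))
  end.

Definition smooth_on (R : realType) (W : normedModType R)
    (U : set 'rV[R]_4) (f : 'rV[R]_4 -> W) : Prop :=
  forall k, Ck_on k U f.

(* A chart is a homeomorphism from an open subset of M onto an open subset of
   R^4.  Both directions are total functions, whose values outside the domain
   (resp. outside the image) are irrelevant. *)
Record chart (R : realType) (M : topologicalType) := Chart {
  cdom : set M;
  coord : M -> 'rV[R]_4;
  cinv : 'rV[R]_4 -> M;
  cdom_open : open cdom;
  cimg_open : open (coord @` cdom);
  coordK : forall p, cdom p -> cinv (coord p) = p;
  coord_continuous : {within cdom, continuous coord};
  cinv_continuous : {within coord @` cdom, continuous cinv}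
}.

Definition cimg (R : realType) (M : topologicalType) (c : chart R M) :
  set 'rV[R]_4 := coord c @` cdom c.

Definition compatible (R : realType) (M : topologicalType) (c d : chart R M) :=
  smooth_on (coord c @` (cdom c `&` cdom d)) (coord d \o cinv c).

(* A smooth structure is a maximal atlas.  Moreover a chart [chart_at p] around
   each point p is singled out, solely to represent the tangent space T_p M: a
   tangent vector at p is given by its components in [chart_at p], so that T_p M
   is 'rV[R]_4 and a vector field is a function M -> 'rV[R]_4 whose value at p
   is read in [chart_at p]. *)
Record smooth_manifold (R : realType) (M : topologicalType) := SmoothManifold {
  atlas : set (chart R M);
  chart_at : M -> chart R M;
  atlas_chart_at : forall p, atlas (chart_at p);
  cdom_chart_at : forall p, cdom (chart_at p) p;
  atlas_compatible : forall c d, atlas c -> atlas d -> compatible c d;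
  atlas_maximal : forall c,
    (forall d, atlas d -> compatible c d /\ compatible d c) -> atlas c;
  manifold_hausdorff : hausdorff_space M;
  manifold_second_countable : @second_countable M
}.

Section Manifold.
Context (R : realType) (M : topologicalType) (S : smooth_manifold R M).
Implicit Types (c : chart R M) (p : M) (x y z u v : 'rV[R]_4).
Implicit Types (X Y Z : M -> 'rV[R]_4).

(* The tangent vector \sum_i v^i d/dX^i at p, where (X^i) are the coordinates
   of the chart c; it is obtained by applying the differential of the change of
   coordinates from c to [chart_at p]. *)
Definition tvec c p v : 'rV[R]_4 :=
  'D_v (coord (chart_at S p) \o cinv c) (coord c p).

(* The components dX^i(x) of a tangent vector x at p in the chart c. *)
Definition comp c p x : 'rV[R]_4 :=
  'D_x (coord c \o cinv (chart_at S p)) (coord (chart_at S p) p).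

(* The derivative x(f) of f in the direction of the tangent vector x at p. *)
Definition dirder (W : normedModType R) p x (f : M -> W) : W :=
  'D_x (f \o cinv (chart_at S p)) (coord (chart_at S p) p).

Definition smooth_near (W : normedModType R) p (f : M -> W) : Prop :=
  exists c (N : set 'rV[R]_4),
    [/\ atlas S c, cdom c p, open N, N (coord c p) & N `<=` cimg c] /\
    smooth_on N (f \o cinv c).

Definition field_smooth_near p X : Prop :=
  exists c (N : set 'rV[R]_4),
    [/\ atlas S c, cdom c p, open N, N (coord c p) & N `<=` cimg c] /\
    smooth_on N (fun t => comp c (cinv c t) (X (cinv c t))).

(* The Lie bracket, [X, Y]^k = X(Y^k) - Y(X^k), with components taken in
   [chart_at p]. *)
Definition bracket X Y p : 'rV[R]_4 :=
  dirder p (X p) (fun p' => comp (chart_at S p) p' (Y p'))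
  - dirder p (Y p) (fun p' => comp (chart_at S p) p' (X p')).

Record riemannian_metric (g : M -> 'rV[R]_4 -> 'rV[R]_4 -> R) : Prop := {
  metric_linear : forall p a x y z, g p (a *: x + y) z = a * g p x z + g p y z;
  metric_sym : forall p x y, g p x y = g p y x;
  metric_pos : forall p x, x != 0 -> 0 < g p x x;
  metric_smooth : forall c u v, atlas S c ->
    smooth_on (cimg c)
      (fun t => g (cinv c t) (tvec c (cinv c t) u) (tvec c (cinv c t) v) : R^o)
}.

(* [nabla p x Y] is the covariant derivative at p of the field Y, defined and
   smooth near p, in the direction of the tangent vector x at p. *)
Record affine_connection (nabla : M -> 'rV[R]_4 -> (M -> 'rV[R]_4) -> 'rV[R]_4)
    : Prop := {
  nabla_linear : forall p a x y Z, field_smooth_near p Z ->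
    nabla p (a *: x + y) Z = a *: nabla p x Z + nabla p y Z;
  nabla_add : forall p x Y Z, field_smooth_near p Y -> field_smooth_near p Z ->
    nabla p x (fun p' => Y p' + Z p') = nabla p x Y + nabla p x Z;
  nabla_leibniz : forall p x (f : M -> R^o) Y,
    smooth_near p f -> field_smooth_near p Y ->
    nabla p x (fun p' => f p' *: Y p')
    = dirder p x f *: Y p + f p *: nabla p x Y;
  nabla_local : forall p x Y Z,
    field_smooth_near p Y -> field_smooth_near p Z ->
    (\forall p' \near p, Y p' = Z p') -> nabla p x Y = nabla p x Z;
  nabla_smooth : forall p X Y, field_smooth_near p X -> field_smooth_near p Y ->
    field_smooth_near p (fun p' => nabla p' (X p') Y)
}.

Record levi_civita (g : M -> 'rV[R]_4 -> 'rV[R]_4 -> R)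
    (nabla : M -> 'rV[R]_4 -> (M -> 'rV[R]_4) -> 'rV[R]_4) : Prop := {
  lc_connection : affine_connection nabla;
  lc_torsion_free : forall p X Y,
    field_smooth_near p X -> field_smooth_near p Y ->
    nabla p (X p) Y - nabla p (Y p) X = bracket X Y p;
  lc_metric : forall p x Y Z, field_smooth_near p Y -> field_smooth_near p Z ->
    dirder p x (fun p' => g p' (Y p') (Z p') : R^o)
    = g p (nabla p x Y) (Z p) + g p (Y p) (nabla p x Z)
}.

(* R(X, Y)Z for vector fields. *)
Definition curvature_op (nabla : M -> 'rV[R]_4 -> (M -> 'rV[R]_4) -> 'rV[R]_4)
    X Y Z p : 'rV[R]_4 :=
  nabla p (X p) (fun p' => nabla p' (Y p') Z)
  - nabla p (Y p) (fun p' => nabla p' (X p') Z)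
  - nabla p (bracket X Y p) Z.

(* The local extension of a tangent vector x at p to a field with constant
   components in [chart_at p]. *)
Definition local_field p x : M -> 'rV[R]_4 :=
  fun p' => tvec (chart_at S p) p' x.

(* The (0,4) curvature tensor at p, evaluated on local extensions of the tangent
   vectors (its value is independent of the extensions).  The sign convention
   R(x, y, z, u) = g(R(x, y)u, z) is the one for which the quotient
   R(x, y, x, y) / (g(x, x) g(y, y) - g(x, y)^2) is the usual sectional
   curvature, positive on round spheres. *)
Definition curvature (g : M -> 'rV[R]_4 -> 'rV[R]_4 -> R)
    (nabla : M -> 'rV[R]_4 -> (M -> 'rV[R]_4) -> 'rV[R]_4) p x y z u : R :=
  g p (curvature_op nabla (local_field p x) (local_field p y)
                    (local_field p u) p) z.

Definition sectional (g : M -> 'rV[R]_4 -> 'rV[R]_4 -> R)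
    (nabla : M -> 'rV[R]_4 -> (M -> 'rV[R]_4) -> 'rV[R]_4) p x y : R :=
  curvature g nabla p x y x y / (g p x x * g p y y - g p x y ^+ 2).

Definition mx_of_rows (rows : seq (seq R)) : 'M[R]_4 :=
  \matrix_(i, j) nth 0 (nth [::] rows i) j.

Definition circulant_metric_mx (A B C : R) : 'M[R]_4 := mx_of_rows
  [:: [:: A; B; C; B];
      [:: B; A; B; C];
      [:: C; B; A; B];
      [:: B; C; B; A]].

Definition circulant_structure_mx : 'M[R]_4 := mx_of_rows
  [:: [:: 0; 1; 0; 0];
      [:: 0; 0; 1; 0];
      [:: 0; 0; 0; 1];
      [:: 1; 0; 0; 0]].

(* The matrix of q acts on columns of components, so that in coordinates
   q (x^1, x^2, x^3, x^4) = (x^2, x^3, x^4, x^1); since components are stored as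
   rows, this is right multiplication by the transpose.  The functions A, B, C
   are functions of the coordinates. *)
Definition circulant_coordinates (g : M -> 'rV[R]_4 -> 'rV[R]_4 -> R)
    (q : M -> {linear 'rV[R]_4 -> 'rV[R]_4}) c : Prop :=
  exists A B C : 'rV[R]_4 -> R^o,
    [/\ smooth_on (cimg c) A, smooth_on (cimg c) B & smooth_on (cimg c) C] /\
    forall p, cdom c p ->
      [/\ 0 < B (coord c p), B (coord c p) < C (coord c p),
          C (coord c p) < A (coord c p),
          \matrix_(i, j) g p (tvec c p (delta_mx 0 i)) (tvec c p (delta_mx 0 j))
          = circulant_metric_mx (A (coord c p)) (B (coord c p)) (C (coord c p))
        & forall v, q p (tvec c p v) = tvec c p (v *m circulant_structure_mx^T)].

Record circulant_manifold (g : M -> 'rV[R]_4 -> 'rV[R]_4 -> R)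
    (q : M -> {linear 'rV[R]_4 -> 'rV[R]_4}) : Prop := {
  circulant_riemannian : riemannian_metric g;
  circulant_local : forall p, exists c,
    [/\ atlas S c, cdom c p & circulant_coordinates g q c]
}.

End Manifold.

Definition induces_q_basis (R : realType) (M : topologicalType)
    (q : M -> {linear 'rV[R]_4 -> 'rV[R]_4}) (p : M) (x : 'rV[R]_4) : Prop :=
  basis_of fullv [:: x; q p x; q p (q p x); q p (q p (q p x))].

(* Main.v *)
Require Import Defs.
From HB Require Import structures.
From mathcomp Require Import all_boot all_order all_algebra.
From mathcomp Require Import all_classical all_reals all_analysis.
From mathcomp Require Import lra.
(* Imported again because [coord] is shadowed by the one of [vector]. *)
Import Defs.
Set Implicit Arguments.
Unset Strict Implicit.
Unset Printing Implicit Defensive.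
Import Order.TTheory GRing.Theory Num.Theory.
Import numFieldNormedType.Exports.
Local Open Scope classical_set_scope.
Local Open Scope ring_scope.

(* The hypothesis says that R is unchanged when q is applied to its last two
   arguments; by the pair symmetry R(x,y,z,u) = R(z,u,x,y) it is also unchanged
   when q is applied to the first two.  As q is an isometry of g, this gives
   mu(qx,qy) = mu(x,y).  Moreover q^4 = id, so applying q twice to the last two
   arguments of R(x,q^2x,x,q^2x) exchanges them, whereas R is skew in them: hence
   mu(x,q^2x) = 0.
   The symmetries of R are proved on fields with constant components in a fixed
   chart, whose brackets vanish near the base point by Schwarz's theorem. *)

(** * Directional derivatives and Schwarz's theorem *)

(** The differential of [f] also serves for [g]: the little-o remainder at [a] only involves values
    near [a], where the two maps agree. *)
Lemma near_eq_differentiable (R : numFieldType) (V W : normedModType R)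
    (f g : V -> W) (a : V) :
  (\near a, f a = g a) -> differentiable f a -> differentiable g a.
Proof.
move=> fg df.
have cdf : continuous ('d f a) by apply: diff_continuous.
have gE : g \o shift a = cst (g a) + 'd f a +o_ (0 : V) id.
  have /diff_locallyP[_ fE] := df.
  apply/eqaddoP => _/posnumP[e].
  have /eqaddoP/(_ e%:num)/(_ [gt0 of e%:num]) := fE.
  rewrite /= !near_simpl; apply: filter_app.
  have : \forall h \near (0 : V), f (h + a) = g (h + a).
    by move: fg; rewrite (near_shift 0 a) /=; apply: filterS => h; rewrite subr0.
  apply: filterS => h /= fgh.
  have fga : f a = g a by exact: (nbhs_singleton fg).
  by rewrite /= -![(_ + _ : _ -> _) _]/(_ + _) -![(- _ : _ -> _) _]/(- _) /= fgh fga.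
have dgE := diff_unique cdf gE.
by apply/diff_locallyP; rewrite dgE; split.
Qed.

Lemma derive_comp (R : numFieldType) (U V W : normedModType R)
    (f : U -> V) (g : V -> W) (a v : U) :
  differentiable f a -> differentiable g (f a) ->
  'D_v (g \o f) a = 'D_('D_v f a) g (f a).
Proof.
move=> df dg; rewrite deriveE; last exact: differentiable_comp.
by rewrite diff_comp // deriveE // deriveE.
Qed.

Lemma derive_linear_dir (R : numFieldType) (V W : normedModType R) (f : V -> W) (a u v : V) (k : R) :
  differentiable f a -> 'D_(k *: u + v) f a = k *: 'D_u f a + 'D_v f a.
Proof. by move=> df; rewrite !deriveE // linearP. Qed.

(** The difference quotients of the restriction to the line are literally those defining the
    directional derivative. This brings the one-variable mean value theorem to bear on [f]. *)
Lemma is_derive_line (R : numFieldType) (V W : normedModType R) (f : V -> W)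
    (b v : V) (s : R) :
  derivable f (b + s *: v) v ->
  is_derive s 1 (fun t : R => f (b + t *: v)) ('D_v f (b + s *: v)).
Proof.
have E : (fun h : R => h^-1 *:
     (((fun t : R => f (b + t *: v)) \o shift s) (h *: (1 : R)) - f (b + s *: v)))
  = (fun h : R => h^-1 *: ((f \o shift (b + s *: v)) (h *: v) - f (b + s *: v))).
  apply/funext => h /=; congr (_ *: (f _ - _)).
  by rewrite [_%:A]mulr1 scalerDl addrCA.
move=> df; split.
- by rewrite /derivable E.
- by rewrite /derive E.
Qed.

(** The mean value theorem is applied twice, first along [v] and then along [w], on a parallelogram
    with corner [a] that lies in the ball of radius [r]. *)
Lemma second_difference_MVT (R : realType) (V : normedModType R) (f : V -> R^o)
    (a v w : V) (h r : R) :
  (forall y, `|y - a| < r -> differentiable f y /\ differentiable ('D_v f) y) ->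
  0 < h -> h * (`|v| + `|w|) < r ->
  exists y, `|y - a| < h * (`|v| + `|w|) + h /\
    f (a + h *: v + h *: w) - f (a + h *: v) - (f (a + h *: w) - f a)
    = h ^+ 2 * 'D_w ('D_v f) y.
Proof.
move=> df h0 hr.
have close s t : 0 <= s <= h -> 0 <= t <= h ->
    `|a + s *: v + t *: w - a| <= h * (`|v| + `|w|).
  move=> /andP[s0 sh] /andP[t0 th].
  rewrite -(addrA a) [_ - a]addrC addKr.
  apply: (le_trans (ler_normD _ _)); rewrite !normrZ !ger0_norm // mulrDr.
  by apply: lerD; apply: ler_wpM2r.
have h0' : 0 <= h <= h by rewrite lexx ltW.
have z0 : 0 <= (0 : R) <= h by rewrite lexx ltW.
(* The second difference is [phi h - phi 0], an increment along [v] of a difference taken along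
   [w]. *)
pose phi (s : R) : R := f (a + h *: w + s *: v) - f (a + s *: v).
have Dphi s : 0 <= s <= h ->
    is_derive s 1 phi ('D_v f (a + h *: w + s *: v) - 'D_v f (a + s *: v)).
  move=> sh; apply: is_deriveB; apply: is_derive_line; apply: diff_derivable.
  - by apply: (df _ _).1; rewrite (addrAC a); apply: le_lt_trans hr; apply: close.
  - apply: (df _ _).1; apply: le_lt_trans hr.
    by have := close s 0 sh z0; rewrite scale0r addr0.
have cphi : {within `[0, h], continuous phi}.
  apply: derivable_within_continuous => s; rewrite in_itv /= => /Dphi sI.
  exact: ex_derive.
have [s sI Es] : exists2 s, s \in `]0, h[%R & phi h - phi 0
    = ('D_v f (a + h *: w + s *: v) - 'D_v f (a + s *: v)) * (h - 0).
  apply: (@MVT R phi (fun s => 'D_v f (a + h *: w + s *: v) - 'D_v f (a + s *: v))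
    0 h h0 _ cphi).
  by move=> s; rewrite in_itv /= => /andP[s0 sh]; apply: Dphi; rewrite !ltW.
have {sI} sI : 0 <= s <= h by move: sI; rewrite in_itv /= => /andP[/ltW-> /ltW->].
(* With [s] fixed by the first application, the value found for the derivative of [phi] is the
   increment [psi h - psi 0]. *)
pose psi (t : R) : R := 'D_v f (a + s *: v + t *: w).
have Dpsi t : 0 <= t <= h -> is_derive t 1 psi ('D_w ('D_v f) (a + s *: v + t *: w)).
  move=> tI; apply: (@is_derive_line _ _ _ ('D_v f)); apply: diff_derivable.
  by apply: (df _ _).2; apply: le_lt_trans hr; apply: close.
have cpsi : {within `[0, h], continuous psi}.
  apply: derivable_within_continuous => t; rewrite in_itv /= => /Dpsi tI.
  exact: ex_derive.
have [t tI Et] : exists2 t, t \in `]0, h[%R & psi h - psi 0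
    = 'D_w ('D_v f) (a + s *: v + t *: w) * (h - 0).
  apply: (@MVT R psi (fun t => 'D_w ('D_v f) (a + s *: v + t *: w)) 0 h h0 _ cpsi).
  by move=> t; rewrite in_itv /= => /andP[t0 th]; apply: Dpsi; rewrite !ltW.
have {tI} tI : 0 <= t <= h by move: tI; rewrite in_itv /= => /andP[/ltW-> /ltW->].
exists (a + s *: v + t *: w); split.
  by apply: (le_lt_trans (close _ _ sI tI)); rewrite ltrDl.
move: Es Et; rewrite /phi /psi !scale0r !addr0 !subr0 => Es Et.
rewrite expr2 -mulrA [h * 'D_w _ _]mulrC -Et (addrAC a (s *: v)) mulrC -Es.
by rewrite (addrAC a (h *: v)).
Qed.

(** The second difference is symmetric in [v] and [w], so the two mixed derivatives take a common
    value at points [y] and [z] close to [a]. By continuity this value is within half the supposed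
    gap of both mixed derivatives at [a], which is absurd. *)
Lemma schwarz_scalar (R : realType) (V : normedModType R) (f : V -> R^o)
    (a v w : V) :
  (\forall y \near a, [/\ differentiable f y, differentiable ('D_v f) y &
     differentiable ('D_w f) y]) ->
  {for a, continuous ('D_w ('D_v f))} -> {for a, continuous ('D_v ('D_w f))} ->
  'D_w ('D_v f) a = 'D_v ('D_w f) a.
Proof.
move=> /nbhs_ballP[r /= r0 dfr] cvw cwv.
have df y : `|y - a| < r -> [/\ differentiable f y, differentiable ('D_v f) y &
     differentiable ('D_w f) y].
  by move=> ya; apply: dfr; rewrite -ball_normE /= distrC.
apply/eqP/negPn/negP => neq.
pose e := `|'D_w ('D_v f) a - 'D_v ('D_w f) a| / 2.
have e0 : 0 < e by rewrite divr_gt0 // normr_gt0 subr_eq0.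
have /cvgrPdist_lt/(_ e e0)/nbhs_ballP[r1 /= r10 near1] := cvw.
have /cvgrPdist_lt/(_ e e0)/nbhs_ballP[r2 /= r20 near2] := cwv.
pose m := Num.min r (Num.min r1 r2).
have m0 : 0 < m by rewrite !lt_min r0 r10.
pose L := `|v| + `|w| + 1.
have L0 : 0 < L by rewrite ltr_wpDl // addr_ge0.
(* Then [h * L = m / 2 < m]. The summand 1 in [L] absorbs the extra [h] in the distance bound and
   keeps [L] positive when [v = w = 0]. *)
pose h := m / 2 / L.
have h0 : 0 < h by rewrite !divr_gt0.
have hL : h * (`|v| + `|w|) + h < m.
  rewrite -[X in _ + X]mulr1 -mulrDr -/L /h divfK ?gt_eqF //.
  by rewrite ltr_pdivrMr // ltr_pMr // ltr1n.
have hLr : h * (`|v| + `|w|) < r.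
  apply: (@lt_trans _ _ (h * (`|v| + `|w|) + h)); first by rewrite ltrDl.
  by apply: (lt_le_trans hL); rewrite ge_min lexx.
have [|y [ya Ey]] := @second_difference_MVT R V f a v w h r _ h0 hLr.
  by move=> y /df[].
have hLr' : h * (`|w| + `|v|) < r by rewrite addrC.
have [|z [za Ez]] := @second_difference_MVT R V f a w v h r _ h0 hLr'.
  by move=> z /df[].
have yz : 'D_w ('D_v f) y = 'D_v ('D_w f) z.
  have h20 : h ^+ 2 != 0 by rewrite expf_neq0 // gt_eqF.
  apply: (@mulfI R _ h20).
  apply: etrans (esym Ey) (etrans _ Ez); rewrite (addrAC a (h *: w)).
  move: (f _) (f _) (f _) (f a) => A B C D.
  by rewrite !opprD !opprK addrACA.
have /near1/= ne1 : ball a r1 y.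
  rewrite -ball_normE /= distrC; apply: (lt_trans ya); apply: (lt_le_trans hL).
  by rewrite !ge_min lexx orbT.
have /near2/= ne2 : ball a r2 z.
  rewrite -ball_normE /= distrC; apply: (lt_trans za); rewrite [`|w| + _]addrC.
  by apply: (lt_le_trans hL); rewrite !ge_min lexx !orbT.
have : `|'D_w ('D_v f) a - 'D_v ('D_w f) a| < e + e.
  move: ne1 ne2; rewrite yz; move: ('D_w _ a) ('D_v _ a) ('D_v _ z) => A B Z.
  by move=> AZ BZ; apply: le_lt_trans (ler_distD Z A B) (ltrD AZ _); rewrite distrC.
by rewrite -splitr ltxx.
Qed.

(** * Smooth maps on open subsets of R^4 *)

Lemma open_near (T : topologicalType) (U : set T) (a : T) :
  open U -> U a -> \forall y \near a, U y.
Proof. by move=> oU Ua; apply: open_nbhs_nbhs. Qed.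

Lemma Ck_on_ext (R : realType) (W : normedModType R) k (U : set 'rV[R]_4)
    (f g : 'rV[R]_4 -> W) :
  open U -> {in U, f =1 g} -> Ck_on k U f -> Ck_on k U g.
Proof.
move=> oU; elim: k f g => [|k IH] f g fg.
  move=> cf y Uy; have nfg : {near y, f =1 g}.
    by apply: filterS (open_near oU Uy) => z Uz; apply: fg; rewrite inE.
  change (g z @[z --> y] --> g y); rewrite -(nbhs_singleton nfg).
  exact: cvg_trans (near_eq_cvg nfg) (cf y Uy).
have nfg y : U y -> {near y, f =1 g}.
  by move=> Uy; apply: filterS (open_near oU Uy) => z Uz; apply: fg; rewrite inE.
move=> [df Df]; split.
  by move=> y Uy; apply: near_eq_differentiable (df y Uy); exact: nfg.
move=> v; apply: IH (Df v) => y /[!inE] Uy.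
by apply: near_eq_derive; exact: nfg.
Qed.

Lemma smooth_on_ext (R : realType) (W : normedModType R) (U : set 'rV[R]_4)
    (f g : 'rV[R]_4 -> W) :
  open U -> {in U, f =1 g} -> smooth_on U f -> smooth_on U g.
Proof. by move=> oU fg sf k; exact: Ck_on_ext (sf k). Qed.

Lemma Ck_onW (R : realType) (W : normedModType R) k (U V : set 'rV[R]_4)
    (f : 'rV[R]_4 -> W) :
  U `<=` V -> Ck_on k V f -> Ck_on k U f.
Proof.
move=> UV; elim: k f => [|k IH] f /=; first by move=> cf y /UV; exact: cf.
by move=> [df Df]; split=> [y /UV|v]; [exact: df|exact/IH/Df].
Qed.

Lemma smooth_on_cst (R : realType) (W : normedModType R) (U : set 'rV[R]_4)
    (w : W) : smooth_on U (cst w).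
Proof.
move=> k; elim: k w => [|k IH] w /=; first by move=> y _; exact: cst_continuous.
split=> [y _|v]; first exact: differentiable_cst.
by rewrite (_ : 'D_v _ = cst 0) //; apply/funext => y; rewrite derive_cst.
Qed.

Lemma smooth_on_derive (R : realType) (W : normedModType R) (U : set 'rV[R]_4)
    (f : 'rV[R]_4 -> W) v : smooth_on U f -> smooth_on U ('D_v f).
Proof. by move=> sf k; exact: (sf k.+1).2. Qed.

Lemma smooth_on_differentiable (R : realType) (W : normedModType R)
    (U : set 'rV[R]_4) (f : 'rV[R]_4 -> W) y :
  smooth_on U f -> U y -> differentiable f y.
Proof. by move=> sf; exact: (sf 1).1. Qed.

Lemma smooth_on_continuous (R : realType) (W : normedModType R)
    (U : set 'rV[R]_4) (f : 'rV[R]_4 -> W) y :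
  smooth_on U f -> U y -> {for y, continuous f}.
Proof. by move=> sf; exact: (sf 0). Qed.

Lemma schwarz_smooth (R : realType) (U : set 'rV[R]_4) (f : 'rV[R]_4 -> R^o)
    (a v w : 'rV[R]_4) :
  open U -> U a -> smooth_on U f -> 'D_w ('D_v f) a = 'D_v ('D_w f) a.
Proof.
move=> oU Ua sf; apply: schwarz_scalar.
- apply: filterS (open_near oU Ua) => y Uy.
  by split; apply: smooth_on_differentiable Uy => //; exact: smooth_on_derive.
- by apply: smooth_on_continuous Ua; do 2!apply: smooth_on_derive.
- by apply: smooth_on_continuous Ua; do 2!apply: smooth_on_derive.
Qed.

Lemma derive_coord (R : realType) (V : normedModType R) (f : V -> 'rV[R]_4)
    (a v : V) j :
  derivable f a v -> 'D_v (fun t => f t 0 j : R^o) a = 'D_v f a 0 j.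
Proof. by move=> df; rewrite derive_mx // mxE. Qed.

Lemma smooth_on_coord (R : realType) (U : set 'rV[R]_4)
    (f : 'rV[R]_4 -> 'rV[R]_4) j :
  open U -> smooth_on U f -> smooth_on U (fun t => f t 0 j : R^o).
Proof.
move=> oU sf k; elim: k f sf => [|k IH] f sf /=.
  move=> y Uy; apply: differentiable_continuous.
  by apply: (differentiable_comp (smooth_on_differentiable sf Uy)
               (differentiable_coord _ _ _)).
split=> [y Uy|v].
  by apply: (differentiable_comp (smooth_on_differentiable sf Uy)
               (differentiable_coord _ _ _)).
apply: (Ck_on_ext (f := fun t => 'D_v f t 0 j)) => //.
  move=> y /[!inE] Uy; rewrite derive_coord //; apply: diff_derivable.
  exact: smooth_on_differentiable sf Uy.
by apply: IH; exact: smooth_on_derive.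
Qed.

(** Derivatives of a vector-valued map are taken componentwise, which reduces the claim to the
    scalar case. *)
Lemma schwarz_smooth_rV (R : realType) (U : set 'rV[R]_4)
    (f : 'rV[R]_4 -> 'rV[R]_4) (a v w : 'rV[R]_4) :
  open U -> U a -> smooth_on U f -> 'D_w ('D_v f) a = 'D_v ('D_w f) a.
Proof.
move=> oU Ua sf.
have E u1 u2 j : 'D_u2 ('D_u1 f) a 0 j = 'D_u2 ('D_u1 (fun t => f t 0 j : R^o)) a.
  rewrite -derive_coord; last first.
    apply: diff_derivable; apply: smooth_on_differentiable Ua.
    exact: smooth_on_derive.
  apply: near_eq_derive; apply: filterS (open_near oU Ua) => y Uy.
  rewrite derive_coord //; apply: diff_derivable.
  exact: smooth_on_differentiable sf Uy.
apply/rowP => j; apply: etrans (E _ _ _) (etrans _ (esym (E _ _ _))).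
exact: schwarz_smooth oU Ua (smooth_on_coord _ oU sf).
Qed.

(** * Charts and local fields *)

Section Charts.
Context (R : realType) (M : topologicalType) (S : smooth_manifold R M).
Implicit Types (c d : chart R M) (p : M) (u v x y z : 'rV[R]_4).
Implicit Types (X Y Z : M -> 'rV[R]_4).

Definition overlap c d : set 'rV[R]_4 := coord c @` (cdom c `&` cdom d).

Lemma open_cimg c : open (cimg c).
Proof. exact: cimg_open. Qed.
Arguments open_cimg : clear implicits.

Lemma cinvK c t : cimg c t -> cdom c (cinv c t) /\ coord c (cinv c t) = t.
Proof. by move=> [p cp <-]; rewrite coordK. Qed.

Lemma coord_near c p (N : set 'rV[R]_4) :
  cdom c p -> open N -> N (coord c p) ->
  \forall p' \near p, cdom c p' /\ N (coord c p').
Proof.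
move=> cp oN Np; apply: filterI; first exact: open_near (cdom_open c) cp.
have := coord_continuous (c := c).
rewrite (continuous_open_subspace _ (cdom_open c)) => cc.
have pc : p \in cdom c by rewrite inE.
have nN := open_near oN Np.
exact: (cc _ pc _ nN).
Qed.

Lemma cinv_near c t (P : M -> Prop) :
  cimg c t -> (\forall p \near cinv c t, P p) ->
  \forall t' \near t, cimg c t' /\ P (cinv c t').
Proof.
move=> ct nP; apply: filterI; first exact: open_near (open_cimg c) ct.
have := cinv_continuous (c := c).
rewrite (continuous_open_subspace _ (@cimg_open _ _ c)) => cc.
have tc : t \in coord c @` cdom c by rewrite inE.
exact: (cc _ tc _ nP).
Qed.

Lemma coord_nearE c p (P : M -> Prop) :
  cdom c p -> (\forall p' \near p, P p') ->
  \forall t \near coord c p, cimg c t /\ P (cinv c t).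
Proof. by move=> cp nP; apply: cinv_near; [exists p|rewrite coordK]. Qed.

Lemma open_overlap c d : open (overlap c d).
Proof.
rewrite openE => _ [p [cp dp] <-]; rewrite /interior.
apply: filterS (coord_nearE cp (open_near (cdom_open d) dp)) => t [ct dt].
by have [cp' <-] := cinvK ct; exists (cinv c t).
Qed.
Arguments open_overlap : clear implicits.

Lemma smooth_transition c d : atlas S c -> atlas S d ->
  smooth_on (overlap c d) (coord d \o cinv c).
Proof. exact: atlas_compatible. Qed.

Lemma differentiable_transition c d p : atlas S c -> atlas S d ->
  cdom c p -> cdom d p -> differentiable (coord d \o cinv c) (coord c p).
Proof.
move=> Sc Sd cp dp; apply: smooth_on_differentiable (smooth_transition Sc Sd) _.
by exists p.
Qed.

Lemma transitionK c d p : cdom c p -> cdom d p ->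
  \forall t \near coord c p, cinv d (coord d (cinv c t)) = cinv c t.
Proof.
move=> cp dp.
apply: filterS (coord_nearE cp (open_near (cdom_open d) dp)) => t [_ dt].
by rewrite coordK.
Qed.

(** * Tangent vectors and derivatives in different charts *)

Lemma differentiable_chart (W : normedModType R) c d p (f : M -> W) :
  atlas S c -> atlas S d -> cdom c p -> cdom d p ->
  differentiable (f \o cinv c) (coord c p) ->
  differentiable (f \o cinv d) (coord d p).
Proof.
move=> Sc Sd cp dp df.
apply: (near_eq_differentiable (f := (f \o cinv c) \o (coord c \o cinv d))).
  by apply: filterS (transitionK dp cp) => t /= ->.
apply: differentiable_comp; first exact: differentiable_transition.
by rewrite /= coordK.
Qed.

(** The chain rule through the transition map from [c] to [chart_at S p]: a derivative along a
    tangent vector may be computed in any chart around [p]. *)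
Lemma dirder_tvec (W : normedModType R) c p v (f : M -> W) :
  atlas S c -> cdom c p -> differentiable (f \o cinv c) (coord c p) ->
  dirder S p (tvec S c p v) f = 'D_v (f \o cinv c) (coord c p).
Proof.
move=> Sc cp df; rewrite /dirder /tvec.
set e := chart_at S p.
have Se : atlas S e := atlas_chart_at S p.
have ep : cdom e p := cdom_chart_at S p.
have -> : coord e p = (coord e \o cinv c) (coord c p) by rewrite /= coordK.
rewrite -derive_comp; first last.
- rewrite /= coordK //; exact: differentiable_chart df.
- exact: differentiable_transition.
by apply: near_eq_derive; apply: filterS (transitionK cp ep) => t /= ->.
Qed.

Lemma comp_tvec c d p v : atlas S c -> atlas S d -> cdom c p -> cdom d p ->
  comp S d p (tvec S c p v) = 'D_v (coord d \o cinv c) (coord c p).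
Proof.
by move=> Sc Sd cp dp; exact: dirder_tvec (differentiable_transition _ _ _ _).
Qed.

Lemma derive_transition_id c t v : cimg c t -> 'D_v (coord c \o cinv c) t = v.
Proof.
move=> ct; rewrite -[RHS](derive_id t v); apply: near_eq_derive.
by apply: filterS (open_near (open_cimg c) ct) => t' /cinvK[].
Qed.

Lemma comp_tvecK c p v : atlas S c -> cdom c p ->
  comp S c p (tvec S c p v) = v.
Proof.
by move=> Sc cp; rewrite comp_tvec // derive_transition_id //; exists p.
Qed.

(** The two transition maps between [c] and [chart_at S p] compose to the identity near the point,
    so by the chain rule their differentials do too. *)
Lemma tvec_compK c p x : atlas S c -> cdom c p ->
  tvec S c p (comp S c p x) = x.
Proof.
move=> Sc cp; rewrite /comp /tvec; set e := chart_at S p.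
have Se : atlas S e := atlas_chart_at S p.
have ep : cdom e p := cdom_chart_at S p.
have -> : coord c p = (coord c \o cinv e) (coord e p) by rewrite /= coordK.
rewrite -derive_comp; first last.
- by rewrite /= coordK //; exact: differentiable_transition.
- exact: differentiable_transition.
rewrite -[RHS](derive_id (coord e p) x); apply: near_eq_derive.
apply: filterS2 (transitionK ep cp) (open_near (open_cimg e) _) => [t /= ->|].
  by move=> /cinvK[].
by exists p.
Qed.

Lemma tvec_linear c p k u v : atlas S c -> cdom c p ->
  tvec S c p (k *: u + v) = k *: tvec S c p u + tvec S c p v.
Proof.
move=> Sc cp; apply: derive_linear_dir; apply: differentiable_transition => //.
- exact: atlas_chart_at.
- exact: cdom_chart_at.
Qed.

Lemma local_fieldE p x : local_field S p x p = x.
Proof.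
by apply: derive_transition_id; exists p => //; exact: cdom_chart_at.
Qed.

Lemma local_field_linear p k x y :
  \forall p' \near p, local_field S p (k *: x + y) p'
    = k *: local_field S p x p' + local_field S p y p'.
Proof.
apply: filterS (open_near (cdom_open _) (cdom_chart_at S p)) => p' cp'.
by apply: tvec_linear => //; exact: atlas_chart_at.
Qed.

Lemma local_field_smooth p x : field_smooth_near S p (local_field S p x).
Proof.
pose c := chart_at S p.
have Sc : atlas S c := atlas_chart_at S p.
have cp : cdom c p := cdom_chart_at S p.
exists c, (cimg c); split; first by split=> //; [exact: open_cimg|exists p].
apply: (smooth_on_ext (f := cst x)); first exact: open_cimg.
  by move=> t /[!inE] /cinvK[ct _]; rewrite comp_tvecK.
exact: smooth_on_cst.
Qed.

Lemma field_smooth_near_near p X : field_smooth_near S p X ->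
  \forall p' \near p, field_smooth_near S p' X.
Proof.
move=> [c [N [[Sc cp oN Np Nc] sX]]].
by apply: filterS (coord_near cp oN Np) => p' [cp' Np']; exists c, N.
Qed.

Lemma field_smooth_near_ext p X Y : field_smooth_near S p X ->
  (\forall p' \near p, X p' = Y p') -> field_smooth_near S p Y.
Proof.
move=> [c [N [[Sc cp oN Np Nc] sX]]] XY.
(* [N] is shrunk to the points around which [X] and [Y] agree on a whole neighbourhood, a condition
   that is itself open. *)
pose N' := N `&` (fun t => \forall p' \near cinv c t, X p' = Y p').
have oN' : open N'.
  rewrite openE => t [Nt /near_join nt]; apply: filterI; first exact: open_near oN Nt.
  by apply: filterS (cinv_near (Nc _ Nt) nt) => t' [].
exists c, N'; split.
  by split=> //; [split=> //; rewrite coordK|move=> t [/Nc]].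
apply: (smooth_on_ext (f := fun t => comp S c (cinv c t) (X (cinv c t)))) => //.
  by move=> t /[!inE] -[_ /nbhs_singleton ->].
by move=> k; apply: Ck_onW (sX k) => t [].
Qed.

(** At [p'] the bracket is read in the chart [d] chosen at [p'], where the fields are the first
    derivatives of the transition map from [c] to [d]. Both terms of the bracket are then mixed
    second derivatives of that map, and they cancel by Schwarz's theorem. *)
Lemma bracket_local_field p y z :
  \forall p' \near p, bracket S (local_field S p y) (local_field S p z) p' = 0.
Proof.
pose c := chart_at S p.
have Sc : atlas S c := atlas_chart_at S p.
apply: filterS (open_near (cdom_open c) (cdom_chart_at S p)) => p' cp'.
pose d := chart_at S p'.
have Sd : atlas S d := atlas_chart_at S p'.
have dp' : cdom d p' := cdom_chart_at S p'.
have oU := open_overlap c d.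
have Up : overlap c d (coord c p') by exists p'.
have sphi := smooth_transition Sc Sd.
have E u v : dirder S p' (local_field S p u p')
      (fun p'' => comp S d p'' (local_field S p v p''))
    = 'D_u ('D_v (coord d \o cinv c)) (coord c p').
  have nE : \forall t \near coord c p', 'D_v (coord d \o cinv c) t
      = ((fun p'' => comp S d p'' (local_field S p v p'')) \o cinv c) t.
    apply: filterS (open_near oU Up) => _ [q [cq dq] <-] /=.
    by rewrite (coordK cq) /local_field comp_tvec.
  have df : differentiable
      ((fun p'' => comp S d p'' (local_field S p v p'')) \o cinv c) (coord c p').
    apply: near_eq_differentiable nE _.
    exact: smooth_on_differentiable (smooth_on_derive v sphi) Up.
  apply: etrans (dirder_tvec u Sc cp' df) _.
  exact/esym/near_eq_derive.
have sw : 'D_y ('D_z (coord d \o cinv c)) (coord c p')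
    = 'D_z ('D_y (coord d \o cinv c)) (coord c p').
  exact: schwarz_smooth_rV oU Up sphi.
by rewrite /bracket (E y z) (E z y) sw subrr.
Qed.

Lemma dirder_near (W : normedModType R) p x (f h : M -> W) :
  (\forall p' \near p, f p' = h p') -> dirder S p x f = dirder S p x h.
Proof.
move=> fh; apply: near_eq_derive.
by apply: filterS (coord_nearE (cdom_chart_at S p) fh) => t [].
Qed.

(** In the chart at [p] the local fields have constant components, so both sides are mixed second
    derivatives of the coordinate expression of [f]. *)
Lemma dirder2_comm p y z (f : M -> R^o) :
  smooth_on (cimg (chart_at S p)) (f \o cinv (chart_at S p)) ->
  dirder S p z (fun p' => dirder S p' (local_field S p y p') f)
  = dirder S p y (fun p' => dirder S p' (local_field S p z p') f).
Proof.
set c := chart_at S p => sf.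
have Sc : atlas S c := atlas_chart_at S p.
have cp : cdom c p := cdom_chart_at S p.
have ip : cimg c (coord c p) by exists p.
have E u v : dirder S p v (fun p' => dirder S p' (local_field S p u p') f)
    = 'D_v ('D_u (f \o cinv c)) (coord c p).
  apply: near_eq_derive.
  apply: filterS (open_near (open_cimg c) ip) => _ [q cq <-] /=.
  rewrite (coordK cq); apply: dirder_tvec => //.
  by apply: smooth_on_differentiable sf _; exists q.
rewrite (E y z) (E z y).
exact: schwarz_smooth (open_cimg c) ip sf.
Qed.

End Charts.

(** * Symmetries of the curvature tensor *)

(** The classical octahedron argument: four instances of the Bianchi identity are combined linearly,
    after the skew symmetries have matched their terms. *)
Lemma pair_symmetry (R : realFieldType) (V : Type) (K : V -> V -> V -> V -> R) :
  (forall x y z u, K y x z u = - K x y z u) ->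
  (forall x y z u, K x y u z = - K x y z u) ->
  (forall x y z u, K x y z u + K y u z x + K u x z y = 0) ->
  forall x y z u, K x y z u = K z u x y.
Proof.
move=> a12 a34 B x y z u.
have := B x y u z; have := B y z x u; have := B z u y x; have := B u x z y.
rewrite (a34 x y z u) (a34 y z x u) (a12 x z u y) (a34 x z y u) (a34 z u x y).
rewrite (a12 y u x z) (a34 y u z x) (a34 u x z y).
lra.
Qed.

Lemma alternating_skew (V W : zmodType) (b : V -> V -> W) :
  (forall x y z, b (x + y) z = b x z + b y z) ->
  (forall x y z, b x (y + z) = b x y + b x z) ->
  (forall x, b x x = 0) -> forall x y, b y x = - b x y.
Proof.
move=> bl br b0 x y; apply/eqP; rewrite -addr_eq0.
by have := b0 (x + y); rewrite bl !br !b0 addr0 add0r addrC => ->.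
Qed.

Section Curvature.
Context (R : realType) (M : topologicalType) (S : smooth_manifold R M).
Context (g : M -> 'rV[R]_4 -> 'rV[R]_4 -> R).
Context (nabla : M -> 'rV[R]_4 -> (M -> 'rV[R]_4) -> 'rV[R]_4).
Context (gR : riemannian_metric S g) (LC : levi_civita S g nabla).
Implicit Types (p : M) (x y z u v w : 'rV[R]_4).
Implicit Types (X Y Z : M -> 'rV[R]_4).

Local Notation lf := (local_field S).
Local Notation Rop p x y z := (curvature_op S nabla (lf p x) (lf p y) (lf p z) p).
Local Notation K p := (curvature S g nabla p).

Let AC := lc_connection LC.

Lemma metricD p x y z : g p (x + y) z = g p x z + g p y z.
Proof. by rewrite -[x]scale1r (metric_linear gR) mul1r scale1r. Qed.

Lemma metric0 p z : g p 0 z = 0.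
Proof. by apply: (addrI (g p 0 z)); rewrite -metricD !addr0. Qed.

Lemma metricZ p k x z : g p (k *: x) z = k * g p x z.
Proof. by rewrite -[k *: x]addr0 (metric_linear gR) metric0 addr0. Qed.

Lemma metricN p x z : g p (- x) z = - g p x z.
Proof. by rewrite -scaleN1r metricZ mulN1r. Qed.

Lemma nabla0 p Z : field_smooth_near S p Z -> nabla p 0 Z = 0.
Proof.
move=> sZ; apply: (addrI (nabla p 0 Z)).
by have := nabla_linear AC 1 0 0 sZ; rewrite !scale1r !addr0 => <-.
Qed.

Lemma local_fields_smooth_near p z :
  \forall p' \near p, field_smooth_near S p' (lf p z).
Proof. exact: field_smooth_near_near (local_field_smooth S p z). Qed.

(** The covariant derivative kept as a field around [p], so that it can be differentiated once
    more. *)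
Definition nabla_local_field p y z : M -> 'rV[R]_4 :=
  fun p' => nabla p' (lf p y p') (lf p z).

Local Notation D := nabla_local_field.

Lemma nabla_local_field_smooth p y z : field_smooth_near S p (D p y z).
Proof. by apply: (nabla_smooth AC); exact: local_field_smooth. Qed.

(** Vanishing torsion makes the difference of the two sides a bracket of local fields, which is zero
    near [p]. *)
Lemma nabla_local_fieldC p y z : \forall p' \near p, D p y z p' = D p z y p'.
Proof.
apply: filterS3 (bracket_local_field S p y z) (local_fields_smooth_near p y)
  (local_fields_smooth_near p z) => p' b0 sy sz.
by apply/eqP; rewrite -subr_eq0 (lc_torsion_free LC) // b0.
Qed.

(** The local field of [z + u] is the sum of the two local fields only near [p], so additivity of
    the connection is combined with its locality. *)
Lemma nabla_local_fieldD p y z u : \forall p' \near p,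
  D p y (z + u) p' = D p y z p' + D p y u p'.
Proof.
apply: filterS3 (local_fields_smooth_near p z) (local_fields_smooth_near p u)
  (filterI (local_fields_smooth_near p (z + u))
           (near_join (local_field_linear S p 1 z u))) => p' sz su [szu zu].
have {}zu : \forall p'' \near p', lf p (z + u) p'' = lf p z p'' + lf p u p''.
  by apply: filterS zu => p''; rewrite !scale1r.
have sum_smooth := field_smooth_near_ext szu zu.
exact: etrans (nabla_local AC _ szu sum_smooth zu) (nabla_add AC _ sz su).
Qed.

(** The bracket of the two local fields vanishes at [p], which removes the third term of the
    curvature. *)
Lemma curvature_opE p x y z :
  Rop p x y z = nabla p x (D p y z) - nabla p y (D p x z).
Proof.
rewrite /curvature_op (nbhs_singleton (bracket_local_field S p x y)) !local_fieldE.
by rewrite nabla0 ?subr0 //; exact: local_field_smooth.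
Qed.

Lemma nabla_nabla_local_fieldC p x y z :
  nabla p x (D p y z) = nabla p x (D p z y).
Proof.
apply: (nabla_local AC); try exact: nabla_local_field_smooth.
exact: nabla_local_fieldC.
Qed.

Lemma curvature_op_skew p x y z : Rop p y x z = - Rop p x y z.
Proof.
have opprB_eq (a b c d : 'rV[R]_4) : c = a - b -> d = b - a -> d = - c.
  by move=> -> ->; rewrite opprB.
exact: (opprB_eq _ _ _ _ (curvature_opE p x y z) (curvature_opE p y x z)).
Qed.

(** The cyclic sum consists of six second covariant derivatives, which cancel in pairs once the
    symmetry of [D] in its two vectors is used. *)
Lemma curvature_op_bianchi p x y z :
  Rop p x y z + Rop p y z x + Rop p z x y = 0.
Proof.
have cyclic_sum0 (a b c a' b' c' r1 r2 r3 : 'rV[R]_4) : a' = a -> b' = b ->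
    c' = c -> r1 = a - b -> r2 = b' - c -> r3 = c' - a' -> r1 + r2 + r3 = 0.
  by move=> -> -> -> -> -> ->; rewrite subrKA subrKA subrr.
exact: (cyclic_sum0 _ _ _ _ _ _ _ _ _ (nabla_nabla_local_fieldC p x z y)
  (nabla_nabla_local_fieldC p y z x) (nabla_nabla_local_fieldC p z x y)
  (curvature_opE p x y z) (curvature_opE p y z x) (curvature_opE p z x y)).
Qed.

Lemma nabla_nabla_local_fieldD p x y z u :
  nabla p x (D p y (z + u)) = nabla p x (D p y z) + nabla p x (D p y u).
Proof.
have sD v := nabla_local_field_smooth p y v.
rewrite -(nabla_add AC) //; apply: (nabla_local AC) => //.
  exact: field_smooth_near_ext (sD _) (nabla_local_fieldD p y z u).
exact: nabla_local_fieldD.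
Qed.

Lemma curvature_opD p x y z u : Rop p x y (z + u) = Rop p x y z + Rop p x y u.
Proof.
have subr_eqD (a b a1 b1 a2 b2 c c1 c2 : 'rV[R]_4) : c = a - b ->
    c1 = a1 - b1 -> c2 = a2 - b2 -> a = a1 + a2 -> b = b1 + b2 -> c = c1 + c2.
  by move=> -> -> -> -> ->; rewrite opprD addrACA.
exact: (subr_eqD _ _ _ _ _ _ _ _ _ (curvature_opE p x y (z + u))
  (curvature_opE p x y z) (curvature_opE p x y u)
  (nabla_nabla_local_fieldD p x y z u) (nabla_nabla_local_fieldD p y x z u)).
Qed.

(* Differentiating [g z z] along [y] gives [2 g (nabla_y z) z], written here as
   [g (nabla_y (z + z)) z] so that it is the metric product of two smooth fields
   and compatibility with the metric applies a second time. *)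
Lemma dirder2_metric p x y z :
  dirder S p x (fun p' => dirder S p' (lf p y p')
                            (fun p'' => g p'' (lf p z p'') (lf p z p'') : R^o))
  = g p (nabla p x (D p y (z + z))) z
    + g p (D p y (z + z) p) (nabla p x (lf p z)).
Proof.
have [sz sD] := (local_field_smooth S p z, nabla_local_field_smooth p y (z + z)).
have := lc_metric LC x sD sz; rewrite [lf p z p]local_fieldE => <-.
apply: dirder_near.
apply: filterS2 (local_fields_smooth_near p z) (nabla_local_fieldD p y z z).
move=> p' sz' ->; rewrite (lc_metric LC) // metricD; congr (_ + _).
exact: (metric_sym gR).
Qed.

(** The iterated derivatives of [g z z] along [x] and [y] commute. Expanded by metric compatibility,
    their cross terms agree by symmetry of [g], and what remains of the difference is the curvature
    term. *)
Lemma curvature_op_metric p x y z : g p (Rop p x y (z + z)) z = 0.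
Proof.
have sf : smooth_on (cimg (chart_at S p))
   ((fun p'' => g p'' (lf p z p'') (lf p z p'') : R^o) \o cinv (chart_at S p)).
  exact: (metric_smooth gR) (atlas_chart_at S p).
have gxy := etrans (esym (dirder2_metric p x y z))
  (etrans (dirder2_comm y x sf) (dirder2_metric p y x z)).
have D2 v : D p v (z + z) p = nabla p v (lf p z) + nabla p v (lf p z).
  by rewrite (nbhs_singleton (nabla_local_fieldD p v z z)) /D local_fieldE.
have cross : g p (D p y (z + z) p) (nabla p x (lf p z))
    = g p (D p x (z + z) p) (nabla p y (lf p z)).
  by rewrite (D2 x) (D2 y) !metricD (metric_sym gR p (nabla p y _)).
rewrite cross in gxy; move/addIr: gxy => gxy.
apply: etrans (congr1 (g p ^~ z) (curvature_opE p x y (z + z))) _.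
by rewrite metricD metricN gxy subrr.
Qed.

Lemma curvature_skew12 p x y z u : K p y x z u = - K p x y z u.
Proof. by rewrite /curvature curvature_op_skew metricN. Qed.

(** Since [K p x y z u] is the product of R(x, y)u with [z], the cyclic permutation acts on the
    first, second and fourth arguments. *)
Lemma curvature_bianchi p x y z u :
  K p x y z u + K p y u z x + K p u x z y = 0.
Proof. by rewrite /curvature -!metricD curvature_op_bianchi metric0. Qed.

Lemma curvature_skew34 p x y z u : K p x y u z = - K p x y z u.
Proof.
(* By additivity the previous identity says that twice this product is zero. Polarization then gives
   skewness. *)
have K0 w : g p (Rop p x y w) w = 0.
  have := curvature_op_metric p x y w; rewrite curvature_opD metricD; lra.
apply: (@alternating_skew _ _ (fun v w => g p (Rop p x y v) w)) => //.
  by move=> v w w'; rewrite -metricD; congr (g p _ w'); exact: curvature_opD.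
by move=> v w w'; rewrite !(metric_sym gR p (Rop p x y v)) metricD.
Qed.

Lemma curvature_pairC p x y z u : K p x y z u = K p z u x y.
Proof.
by apply: pair_symmetry => *; [exact: curvature_skew12|exact: curvature_skew34|
  exact: curvature_bianchi].
Qed.
End Curvature.

(** * Circulant structure *)

Lemma mul_circulant_structure (R : realType) (v : 'rV[R]_4) :
  v *m (circulant_structure_mx R)^T = \row_(j < 4) v 0 (ordS j).
Proof.
apply/rowP => j; rewrite !mxE !big_ord_recl big_ord0.
case: j => -[|[|[|[|//]]]] lt_j4; rewrite !mxE /= ?(mulr0, mulr1, add0r, addr0).
all: by congr (v _ _); apply: val_inj.
Qed.

(** In a circulant matrix an entry depends only on the difference of its indices modulo 4; here the
    sixteen cases are checked. *)
Lemma circulant_metric_mx_ordS (R : realType) (A B C : R) i j :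
  circulant_metric_mx A B C (ordS i) (ordS j) = circulant_metric_mx A B C i j.
Proof.
rewrite !mxE; case: i => -[|[|[|[|//]]]] lti; case: j => -[|[|[|[|//]]]] ltj //.
Qed.

Lemma bilinear_form_mx (R : pzRingType) n (b : 'rV[R]_n -> 'rV[R]_n -> R) :
  (forall k u v w, b (k *: u + v) w = k * b u w + b v w) ->
  (forall k u v w, b w (k *: u + v) = k * b w u + b w v) ->
  forall v w, b v w
    = \sum_i \sum_j v 0 i * (w 0 j * b (delta_mx 0 i) (delta_mx 0 j)).
Proof.
move=> bl br v w.
have b0l u : b 0 u = 0.
  by apply: (addrI (b 0 u)); have := bl 1 0 0 u; rewrite scale1r mul1r !addr0 => <-.
have b0r u : b u 0 = 0.
  by apply: (addrI (b u 0)); have := br 1 0 0 u; rewrite scale1r mul1r !addr0 => <-.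
have blD u1 u2 u : b (u1 + u2) u = b u1 u + b u2 u.
  by rewrite -[u1 in LHS]scale1r bl mul1r.
have brD u1 u2 u : b u (u1 + u2) = b u u1 + b u u2.
  by rewrite -[u1 in LHS]scale1r br mul1r.
rewrite [in LHS](row_sum_delta v) (big_morph (b ^~ w) (fun u1 u2 => blD u1 u2 w) (b0l w)).
apply: eq_bigr => i _; rewrite -[_ *: _]addr0 bl b0l addr0.
rewrite [in LHS](row_sum_delta w) (big_morph (b _) (fun u1 u2 => brD u1 u2 _) (b0r _)).
rewrite mulr_sumr; apply: eq_bigr => j _.
by rewrite -[_ *: _]addr0 br b0r addr0.
Qed.

Section Circulant.
Context (R : realType) (M : topologicalType) (S : smooth_manifold R M).
Context (g : M -> 'rV[R]_4 -> 'rV[R]_4 -> R).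
Context (q : M -> {linear 'rV[R]_4 -> 'rV[R]_4}).
Context (hgq : circulant_manifold S g q).

Lemma circulant_order4 p x : q p (q p (q p (q p x))) = x.
Proof.
have [c [Sc cp [A [B [C [_ /(_ p cp)[_ _ _ _ qE]]]]]]] := circulant_local hgq p.
rewrite -(tvec_compK x Sc cp) !qE !mul_circulant_structure; congr (tvec _ _ _ _).
apply/rowP => j; rewrite !mxE; congr (comp _ _ _ _ _ _); apply: val_inj.
by case: j => -[|[|[|[|//]]]].
Qed.

(** In circulant coordinates [q] shifts components cyclically, and the Gram matrix of [g] is
    invariant under shifting both of its indices. *)
Lemma circulant_isometry p x y : g p (q p x) (q p y) = g p x y.
Proof.
have [c [Sc cp [A [B [C [_ /(_ p cp)[_ _ _ gE qE]]]]]]] := circulant_local hgq p.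
have gR := circulant_riemannian hgq.
have := tvec_compK x Sc cp; move: (comp S c p x) => v <-.
have := tvec_compK y Sc cp; move: (comp S c p y) => w <-.
rewrite (qE v) (qE w).
have bE := @bilinear_form_mx R 4 (fun v w => g p (tvec S c p v) (tvec S c p w)) _ _.
have {}bE v' w' : g p (tvec S c p v') (tvec S c p w') = \sum_i \sum_j v' 0 i *
    (w' 0 j * circulant_metric_mx (A (coord c p)) (B (coord c p)) (C (coord c p)) i j).
  rewrite bE; first by apply: eq_bigr => i _; apply: eq_bigr => j _; rewrite -gE mxE.
  - by move=> k u1 u2 u; rewrite (tvec_linear _ _ _ Sc cp) (metric_linear gR).
  - move=> k u1 u2 u; rewrite (tvec_linear k u1 u2 Sc cp).
    rewrite !(metric_sym gR p (tvec S c p u)).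
    exact: metric_linear gR _ _ _ _ _.
rewrite (bE v w) bE !mul_circulant_structure.
(* Both summation indices on the right are shifted by the cyclic successor, to match the shifted
   components on the left. *)
rewrite [RHS](reindex_inj (@ordS_inj 4)); apply: eq_bigr => i _.
rewrite [RHS](reindex_inj (@ordS_inj 4)); apply: eq_bigr => j _.
by rewrite !(mxE, circulant_metric_mx_ordS).
Qed.
End Circulant.

Theorem theorem4p1 (R : realType) (M : topologicalType)
    (S : smooth_manifold R M)
    (g : M -> 'rV[R]_4 -> 'rV[R]_4 -> R)
    (q : M -> {linear 'rV[R]_4 -> 'rV[R]_4})
    (nabla : M -> 'rV[R]_4 -> (M -> 'rV[R]_4) -> 'rV[R]_4)
    (hgq : circulant_manifold S g q)
    (hnabla : levi_civita S g nabla)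
    (hR : forall (p : M) (x y z u : 'rV[R]_4),
        curvature S g nabla p x y (q p z) (q p u)
        = curvature S g nabla p x y z u)
    (p : M) (x : 'rV[R]_4) (hx : induces_q_basis q p x) :
  let mu := sectional S g nabla p in
  let qx := q p x in
  let q2x := q p qx in
  let q3x := q p q2x in
  [/\ mu x qx = mu qx q2x, mu qx q2x = mu q2x q3x & mu q2x q3x = mu q3x x]
  /\ (mu x q2x = 0 /\ mu qx q3x = 0).
Proof.
have gR := circulant_riemannian hgq.
have pairC := curvature_pairC gR hnabla p.
have muq y z : sectional S g nabla p (q p y) (q p z) = sectional S g nabla p y z.
  rewrite /sectional !(circulant_isometry hgq); congr (_ / _).
  (* K(qy,qz,qy,qz) = K(qy,qz,y,z) = K(y,z,qy,qz) = K(y,z,y,z), the middle equality being pair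
     symmetry. *)
  apply: etrans (hR p _ _ y z) _; apply: etrans (pairC _ _ _ _) _.
  exact: hR.
have mu0 y : sectional S g nabla p y (q p (q p y)) = 0.
  suff K0 : curvature S g nabla p y (q p (q p y)) y (q p (q p y)) = 0.
    by rewrite /sectional K0 mul0r.
  (* This instance reads K(y,q^2y,q^2y,q^4y) = K(y,q^2y,qy,q^3y). With q^4 = id and skewness the
     left side is -K(y,q^2y,y,q^2y), and a second use of the hypothesis turns the right side into
     K(y,q^2y,y,q^2y). *)
  have := hR p y (q p (q p y)) (q p y) (q p (q p (q p y))).
  rewrite (circulant_order4 hgq) hR (curvature_skew34 gR hnabla) => K0.
  lra.
have mu3 : sectional S g nabla p (q p (q p (q p x))) x = sectional S g nabla p x (q p x).
  (* Applying q to both vectors turns (q^3x, x) into (q^4x, qx) = (x, qx). *)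
  by rewrite -[in LHS](muq _ x) (circulant_order4 hgq).
rewrite /= mu3 !muq !mu0.
by split.
Qed.
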